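(* If a sequence of graphs $(G_1,\ldots,G_r)$ with common vertex set $V$ is $(\frac{1}{2}\alpha\rho,\rho',\epsilon,t)$-sparse and $(\alpha,\rho,\epsilon/4,2)$-sparse, then $(G_1,\ldots,G_r)$ is also $(\alpha,\frac{1}{2}\rho\rho',\epsilon,2t)$-sparse.
   Context: Graphs are finite and simple. For a graph $G=(V,E)$ and disjoint subsets $W_1,\ldots,W_t \subset V$ with $t\geq 2$, the density is $d_G(W_1,\ldots,W_t)=\frac{\sum_{ i < j} e(W_i,W_j)}{\sum_{i < j } |W_i||W_j|}$, where $e(W_i,W_j)$ is the number of edges of $G$ with one endpoint in $W_i$ and the other in $W_j$; if $t=1$ the density is defined to be zero. For $\alpha,\rho,\epsilon \in [0,1]$ and a positive integer $t$, a sequence $(G_1,\ldots,G_r)$ of graphs on the same vertex set $V$ is $(\alpha,\rho,\epsilon,t)$-sparse if for all subsets $U \subset V$ with $|U| \geq \alpha |V|$, there are positive integers $t_1,\ldots,t_r$ such that $\prod_{i=1}^r t_i \geq t$ and for each $i \in [r]=\{1,\ldots,r\}$ there are disjoint subsets $W_{i,1},\ldots,W_{i,t_i} \subset U$ with $|W_{i,1}|=\ldots =|W_{i,t_i}|=\lceil \rho |U|\rceil$ and $d_{G_i}(W_{i,1},\ldots,W_{i,t_i})\leq \epsilon$. Throughout, floor and ceiling signs are systematically omitted whenever they are not crucial. *)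

(* Defs.v *)
From mathcomp Require Import all_boot all_order all_algebra.
From mathcomp Require Import reals.

Set Implicit Arguments.
Unset Strict Implicit.
Unset Printing Implicit Defensive.

Import Order.TTheory GRing.Theory Num.Theory.

Local Open Scope ring_scope.

Record sgraph (V : finType) := SGraph {
  adj : rel V;
  adj_sym : symmetric adj;
  adj_irr : irreflexive adj }.

(* Ordered pairs in A x B: for disjoint A and B, the only case in which this is
   used, every edge between A and B is counted exactly once. *)
Definition edges_between (V : finType) (G : sgraph V) (A B : {set V}) : nat :=
  #|[set p in setX A B | adj G p.1 p.2]|.

(* For t = 1 both sums are empty, and 0 / 0 = 0 is the required value; the same
   convention gives density 0 when all the products #|W i| * #|W j| vanish. *)
Definition density (R : realType) (V : finType) (G : sgraph V) (t : nat)
    (W : 'I_t -> {set V}) : R :=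
  (\sum_(i < t) \sum_(j < t | i < j) edges_between G (W i) (W j))%N%:R /
  (\sum_(i < t) \sum_(j < t | i < j) #|W i| * #|W j|)%N%:R.

Definition sparse (R : realType) (V : finType) (r : nat)
    (G : 'I_r -> sgraph V) (alpha rho eps : R) (t : nat) : Prop :=
  forall U : {set V}, alpha * #|V|%:R <= #|U|%:R ->
  exists s : 'I_r -> nat,
    [/\ forall i, (0 < s i)%N,
        (t <= \prod_(i < r) s i)%N
      & forall i, exists W : 'I_(s i) -> {set V},
          [/\ forall k, W k \subset U,
              forall k l, k != l -> [disjoint W k & W l],
              forall k, #|W k|%:Z = Num.ceil (rho * #|U|%:R)
            & density R (G i) W <= eps]].

(* Main.v *)
Require Import Defs.
From mathcomp Require Import all_boot all_order all_algebra.
From mathcomp Require Import reals.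
From mathcomp Require Import zify ring lra.

Set Implicit Arguments.
Unset Strict Implicit.
Unset Printing Implicit Defensive.

Import Order.TTheory GRing.Theory Num.Theory.

Local Open Scope ring_scope.

(** Let U be a large set.  Applying the second sparsity hypothesis to U yields
    an index i and two disjoint sets X1, X2 in U of size n = ceil (rho |U|)
    whose density in G i is at most eps / 4 ([low_density_pair]).  Discarding
    the vertices of X1 with degree more than (eps / 2) |X2| to X2 leaves Y1,
    at least half of X1, which is large enough for the first hypothesis;
    it gives families A_j in Y1, one for each index j.  Every vertex of Y1 has
    degree at most (eps / 2) |X2| to X2, so the union of the sets of A_i has
    density at most eps / 2 to X2, and discarding vertices of X2 in the same
    way leaves Y2, at least half of X2, each of whose vertices sends at most an
    eps fraction of the possible edges to that union ([bipartite_refine]).  The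
    first hypothesis applied to Y2 gives families B_j.

    For the index i the families A_i and B_i are put together: the pairs
    inside each family are sparse by hypothesis, and the cross pairs are sparse
    because every vertex of Y2 has low degree to the sets of A_i
    ([excess_cat], [cross_excess_le0]).  For any other index the longer of A_j
    and B_j is kept.  The product of the lengths is then at least 2 t, because
      (a_i + b_i) * prod_(j != i) max (a_j, b_j) >= prod_j a_j + prod_j b_j,
    where a_j and b_j are the lengths of A_j and B_j ([prod_gain]).

    The sets obtained have sizes ceil (rho' |Y1|) and ceil (rho' |Y2|), which
    may differ from each other and exceed the prescribed size
    m = ceil (rho rho' |U| / 2).  A random m-subset of each set preserves the
    expected density of each pair, so some choice of m-subsets does not
    increase the sum of the pair densities ([excess_shrink]).  This is why the
    proof works with that sum, in the form of [excess], instead of with the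
    number of edges: it gives each pair the same weight whatever the sizes, and
    for sets of equal size it decides whether the density is at most eps
    ([density_le_excess]). *)

(** * Pair densities and excess *)

Definition pair_density (R : realType) (V : finType) (G : sgraph V)
    (A B : {set V}) : R :=
  (edges_between G A B)%:R / (#|A| * #|B|)%:R.

(** The sum of the pair densities is compared with eps pair by pair, so that
    concatenating two families simply adds the excess of the cross pairs. *)
Definition excess (R : realType) (V : finType) (G : sgraph V) (eps : R)
    (s : nat) (W : 'I_s -> {set V}) : R :=
  \sum_(i < s) \sum_(j < s | (i < j)%N) (pair_density R G (W i) (W j) - eps).

Lemma edges_betweenE (V : finType) (G : sgraph V) (A B : {set V}) :
  edges_between G A B = (\sum_(x in A) \sum_(y in B) adj G x y)%N.
Proof.
rewrite /edges_between -sum1_card pair_big /= [RHS]big_mkcond [LHS]big_mkcond.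
apply: eq_bigr => -[x y] _; rewrite !inE /=.
by case: (x \in A); case: (y \in B); case: (adj G x y).
Qed.

Lemma edges_between_le (V : finType) (G : sgraph V) (A B : {set V}) :
  (edges_between G A B <= #|A| * #|B|)%N.
Proof.
by rewrite -cardsX; apply/subset_leq_card/subsetP => p; rewrite inE => /andP[].
Qed.

(** Division by zero is harmless here: if A or B is empty, then both the
    pair density and the number of edges vanish. *)
Lemma pair_density_le (R : realType) (V : finType) (G : sgraph V)
    (c : R) (A B : {set V}) : 0 <= c ->
  (pair_density R G A B <= c) =
  ((edges_between G A B)%:R <= c * (#|A| * #|B|)%:R).
Proof.
move=> c0; rewrite /pair_density; have := edges_between_le G A B.
have [->|n0] := posnP (#|A| * #|B|); last by rewrite ler_pdivrMr ?ltr0n.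
by rewrite leqn0 => /eqP ->; rewrite mul0r mulr0 c0 lexx.
Qed.

(** When all sizes equal n > 0, the density is the mean of the pair densities.
    If n = 0 or there is at most one set, then both sides hold, because a
    density with zero denominator is 0 <= eps. *)
Lemma density_le_excess (R : realType) (V : finType) (G : sgraph V) (eps : R)
    (s n : nat) (W : 'I_s -> {set V}) :
  0 <= eps -> (forall k, #|W k| = n) ->
  (density R G W <= eps) = (excess G eps W <= 0).
Proof.
move=> e0 hW; have [n0|n0] := posnP n.
  have pd0 (A B : {set V}) : #|A| = n -> pair_density R G A B = 0.
    by rewrite /pair_density n0 => ->; rewrite mul0n invr0 mulr0.
  have -> : excess G eps W <= 0.
    apply: sumr_le0 => i _; apply: sumr_le0 => j _.
    by rewrite pd0 // sub0r oppr_le0.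
  rewrite /density [X in _ / X%:R]big1 ?invr0 ?mulr0 ?e0 //.
  by move=> i _; rewrite big1 // => j _; rewrite hW n0.
(* P counts the pairs and E the edges: the density is E / (P n^2). *)
set P : nat := \sum_(i < s) \sum_(j < s | (i < j)%N) 1.
set E : nat :=
  \sum_(i < s) \sum_(j < s | (i < j)%N) edges_between G (W i) (W j).
have n2 : 0 < (n * n)%:R :> R by rewrite ltr0n muln_gt0 n0.
have exE : excess G eps W = E%:R / (n * n)%:R - eps * P%:R.
  rewrite /excess /E /P !natr_sum mulr_suml mulr_sumr -sumrB.
  apply: eq_bigr => i _; rewrite !natr_sum mulr_suml mulr_sumr -sumrB.
  by apply: eq_bigr => j _; rewrite /pair_density !hW mulr1.
have -> : density R G W = E%:R / (P * (n * n))%:R.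
  rewrite /density; congr (_ / _%:R).
  rewrite /P big_distrl; apply: eq_bigr => i _; rewrite big_distrl.
  by apply: eq_bigr => j _; rewrite !hW /= mul1n.
rewrite exE subr_le0; have [P0|P0] := posnP P.
  rewrite P0 mul0n invr0 !mulr0 e0.
  suff -> : E = 0%N by rewrite mul0r lexx.
  apply/eqP; rewrite -leqn0 -(muln0 (n * n)) -P0 /P /E.
  rewrite big_distrr leq_sum // => i _; rewrite big_distrr leq_sum // => j _.
  by apply: leq_trans (edges_between_le _ _ _) _; rewrite !hW /= muln1.
rewrite natrM invfM mulrA mulrAC ler_pdivrMr ?ltr0n //.
Qed.

(** * Shrinking the sets of a family *)

(** Removing an element where h is maximal does not raise the average of h;
    repeat until m elements are left. *)
Lemma subset_below_average (R : realType) (V : finType) (h : V -> R)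
    (A : {set V}) (m : nat) : (0 < m)%N -> (m <= #|A|)%N ->
  exists B : {set V}, [/\ B \subset A, #|B| = m &
    (\sum_(b in B) h b) / #|B|%:R <= (\sum_(a in A) h a) / #|A|%:R].
Proof.
move=> m0; have [n] := ubnP #|A|; elim: n A => // n IH A; rewrite ltnS => hA hm.
have [mA|mA] := eqVneq m #|A|; first by exists A.
have [a aA ha] : exists2 a, a \in A & (\sum_(x in A) h x) <= #|A|%:R * h a.
  have [x0 x0A] : exists x, x \in A.
    by apply/set0Pn; rewrite -card_gt0 (leq_trans m0).
  case: (@Order.TotalTheory.arg_maxP _ R V x0 (mem A) h x0A) => a aA hmax.
  exists a => //; rewrite mulr_natl -sumr_const.
  by apply: ler_sum => x xA; apply: hmax.
have cA := cardsD1 a A; rewrite aA add1n in cA.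
have [||B [BA cB hB]] := IH (A :\ a); [lia | lia |].
exists B; split=> //; first exact: subset_trans BA (subD1set _ _).
apply: le_trans hB _.
have hS : \sum_(x in A) h x = h a + \sum_(x in A :\ a) h x.
  exact: big_setD1.
have c0 : (0 < #|A :\ a|)%N by lia.
rewrite ler_pdivrMr ?ltr0n // mulrAC ler_pdivlMr ?ltr0n ?cA //.
rewrite hS in ha *; rewrite cA -natr1 in ha *.
lra.
Qed.

Lemma pair_density_avgl (R : realType) (V : finType) (G : sgraph V)
    (A B : {set V}) :
  pair_density R G A B = (\sum_(a in A) pair_density R G [set a] B) / #|A|%:R.
Proof.
rewrite /pair_density edges_betweenE natrM invfM mulrA mulrAC; congr (_ / _).
rewrite natr_sum mulr_suml; apply: eq_bigr => a _.
by rewrite edges_betweenE cards1 mul1n big_set1.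
Qed.

Lemma pair_density_avgr (R : realType) (V : finType) (G : sgraph V)
    (A B : {set V}) :
  pair_density R G A B = (\sum_(b in B) pair_density R G A [set b]) / #|B|%:R.
Proof.
rewrite /pair_density edges_betweenE exchange_big /= natrM invfM mulrA.
congr (_ / _); rewrite natr_sum mulr_suml; apply: eq_bigr => a _.
rewrite edges_betweenE cards1 muln1; congr (_%:R / _).
by apply: eq_bigr => x _; rewrite big_set1.
Qed.

(** Each pair density is an average over either of its two sets, and no pair
    uses the k-th set twice.  So the excess, as a function of the k-th set
    alone, is the average of its values on singletons. *)
Lemma excess_avg (R : realType) (V : finType) (G : sgraph V) (eps : R)
    (s : nat) (W : 'I_s -> {set V}) (k : 'I_s) (B : {set V}) : (0 < #|B|)%N ->
  excess G eps [eta W with k |-> B] =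
  (\sum_(b in B) excess G eps [eta W with k |-> [set b]]) / #|B|%:R.
Proof.
move=> B0; have Bn : #|B|%:R != 0 :> R by rewrite pnatr_eq0 -lt0n.
have avgc (c : R) : c = (\sum_(b in B) c) / #|B|%:R.
  by rewrite sumr_const -[c *+ _]mulr_natr mulfK.
rewrite /excess exchange_big mulr_suml; apply: eq_bigr => i _.
rewrite exchange_big mulr_suml; apply: eq_bigr => j ij.
rewrite sumrB mulrBl -avgc; congr (_ - _) => /=.
have [ik|_] := eqVneq i k; have [jk|_] := eqVneq j k.
- by move: ij; rewrite ik jk ltnn.
- exact: pair_density_avgl.
- exact: pair_density_avgr.
- exact: avgc.
Qed.

Lemma eq_excess (R : realType) (V : finType) (G : sgraph V) (eps : R)
    (s : nat) (W W' : 'I_s -> {set V}) :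
  W =1 W' -> excess G eps W = excess G eps W'.
Proof.
by move=> h; apply: eq_bigr => i _; apply: eq_bigr => j _; rewrite !h.
Qed.

(** The sets are replaced one after the other: by [excess_avg] the dependence
    on one set is an average over its elements, so [subset_below_average]
    supplies an m-subset that does not increase the excess. *)
Lemma excess_shrink (R : realType) (V : finType) (G : sgraph V) (eps : R)
    (s m : nat) (W : 'I_s -> {set V}) :
  (0 < m)%N -> (forall k, m <= #|W k|)%N ->
  exists W' : 'I_s -> {set V}, [/\ forall k, W' k \subset W k,
    forall k, #|W' k| = m & excess G eps W' <= excess G eps W].
Proof.
move=> m0 hW.
(* After n steps, the sets of index less than n have been replaced. *)
suff H n : exists W' : 'I_s -> {set V}, [/\ forall k, W' k \subset W k,
    forall k, (m <= #|W' k|)%N, forall k : 'I_s, (k < n)%N -> #|W' k| = m &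
    excess G eps W' <= excess G eps W].
  by have [W' [? _ h ?]] := H s; exists W'; split=> // k; apply: h.
elim: n => [|n [W' [sW cW eW le]]]; first by exists W.
have [sn|ns] := leqP s n.
  by exists W'; split=> // k _; apply: eW; apply: leq_trans sn.
pose k := Ordinal ns.
have [B [BW cB hB]] := subset_below_average
  (fun b => excess G eps [eta W' with k |-> [set b]]) m0 (cW k).
exists [eta W' with k |-> B]; split=> [l|l|l|] /=.
- by case: eqP => // ->; apply: subset_trans BW _.
- by case: eqP => // _; rewrite cB.
- rewrite ltnS leq_eqVlt => /orP[/eqP ln|ln].
    by rewrite ifT //; apply/eqP/val_inj.
  by case: eqP => // _; apply: eW.
- rewrite excess_avg ?cB //; rewrite cB in hB.
  apply: le_trans hB _; rewrite -excess_avg; last exact: leq_trans (cW k).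
  apply: le_trans le; rewrite le_eqVlt; apply/orP; left; apply/eqP/eq_excess.
  by move=> l /=; case: eqP => // ->.
Qed.

(** The initial sets may have different sizes; only the resulting ones need to
    have equal size for the excess to control the density.  For m = 0 empty
    sets are taken, since averages over them are meaningless. *)
Lemma density_shrink (R : realType) (V : finType) (G : sgraph V) (eps : R)
    (s m : nat) (W : 'I_s -> {set V}) :
  0 <= eps -> (forall k, m <= #|W k|)%N -> excess G eps W <= 0 ->
  exists W' : 'I_s -> {set V}, [/\ forall k, W' k \subset W k,
    forall k, #|W' k| = m & density R G W' <= eps].
Proof.
move=> e0 hW hex; have [m0|m0] := posnP m.
  exists (fun=> set0); split=> [k|k|]; rewrite ?sub0set ?cards0 //.
  rewrite (density_le_excess _ e0 (fun=> cards0 V)).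
  apply: sumr_le0 => i _; apply: sumr_le0 => j _.
  by rewrite /pair_density cards0 mul0n invr0 mulr0 sub0r oppr_le0.
have [W' [sW cW le]] := excess_shrink G eps m0 hW.
by exists W'; split=> //; rewrite (density_le_excess _ e0 cW) (le_trans le).
Qed.

(** * Concatenating two families *)

Definition family_cat (V : finType) (s s' : nat) (A : 'I_s -> {set V})
    (B : 'I_s' -> {set V}) (k : 'I_(s + s')) : {set V} :=
  match split k with inl i => A i | inr j => B j end.

Lemma family_catl (V : finType) (s s' : nat) (A : 'I_s -> {set V})
    (B : 'I_s' -> {set V}) i : family_cat A B (lshift s' i) = A i.
Proof. by rewrite /family_cat; have := unsplitK (inl i) => /= ->. Qed.

Lemma family_catr (V : finType) (s s' : nat) (A : 'I_s -> {set V})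
    (B : 'I_s' -> {set V}) j : family_cat A B (rshift s j) = B j.
Proof. by rewrite /family_cat; have := unsplitK (inr j) => /= ->. Qed.

Lemma excess_cat (R : realType) (V : finType) (G : sgraph V) (eps : R)
    (s s' : nat) (A : 'I_s -> {set V}) (B : 'I_s' -> {set V}) :
  excess G eps (family_cat A B) = excess G eps A + excess G eps B +
    \sum_(j < s') \sum_(i < s) (pair_density R G (A i) (B j) - eps).
Proof.
rewrite /excess big_split_ord /= addrAC; congr (_ + _).
  rewrite [X in _ = _ + X]exchange_big /= -big_split; apply: eq_bigr => i _ /=.
  rewrite big_mkcond big_split_ord /= -big_mkcond; congr (_ + _).
    by apply: eq_bigr => j _; rewrite !family_catl.
  apply: eq_bigr => j _.
  by rewrite family_catl family_catr ltn_addr.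
apply: eq_bigr => i _; rewrite big_mkcond big_split_ord /= big1 ?add0r.
  rewrite -big_mkcond.
  by apply: eq_big => j; rewrite ?ltn_add2l // !family_catr.
by move=> j _; rewrite ifF //; have := ltn_ord j; lia.
Qed.

(** * Vertices of low degree *)

(** Markov's inequality: if more than half of X had f > 2 c, these elements
    alone would make the sum exceed c |X|. *)
Lemma markov_half (R : realType) (V : finType) (X : {set V}) (f : V -> R)
    (c : R) : 0 <= c -> (forall x, 0 <= f x) ->
  \sum_(x in X) f x <= c * #|X|%:R ->
  (#|X| <= 2 * #|[set x in X | (f x <= 2 * c)%R]|)%N.
Proof.
move=> c0 f0 hs; set Y := [set x in X | _]; rewrite leqNgt; apply/negP => hY.
have sYX : Y \subset X by apply/subsetP => x; rewrite inE => /andP[].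
have cD : #|X :\: Y| = (#|X| - #|Y|)%N by rewrite cardsDS.
have cXY : (#|X| < 2 * #|X :\: Y|)%N by lia.
have {}cXY : #|X|%:R <= 2 * #|X :\: Y|%:R :> R.
  by rewrite -natrM ler_nat ltnW.
have [x0 x0D] : exists x, x \in X :\: Y by apply/set0Pn; rewrite -card_gt0; lia.
have lt : \sum_(x in X :\: Y) 2 * c < \sum_(x in X :\: Y) f x.
  apply: ltr_sum => [|x].
    by apply/hasP; exists x0; rewrite ?mem_index_enum.
  by rewrite !inE => /andP[+ xX]; rewrite xX /= -ltNge.
have le : \sum_(x in X :\: Y) f x <= \sum_(x in X) f x.
  rewrite [leRHS](big_setID Y) /= (setIidPr sYX) lerDr.
  by apply: sumr_ge0.
rewrite sumr_const -mulr_natr in lt.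
have : c * #|X|%:R <= c * (2 * #|X :\: Y|%:R) by apply: ler_wpM2l.
lra.
Qed.

(** Counting edges from B: each of its vertices sees at most a fraction eps of
    the s * a vertices of the sets A i, hence so does B on average. *)
Lemma cross_excess_le0 (R : realType) (V : finType) (G : sgraph V) (eps : R)
    (s a : nat) (A : 'I_s -> {set V}) (B : {set V}) :
  0 <= eps -> (forall i, #|A i| = a) ->
  (forall y, y \in B ->
    \sum_(i < s) \sum_(x in A i) (adj G x y)%:R <= eps * (s * a)%:R) ->
  \sum_(i < s) (pair_density R G (A i) B - eps) <= 0.
Proof.
move=> e0 cA hB; rewrite sumrB sumr_const card_ord subr_le0.
have -> : \sum_(i < s) pair_density R G (A i) B =
    (\sum_(y in B) \sum_(i < s) \sum_(x in A i) (adj G x y)%:R)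
      / (a * #|B|)%:R.
  rewrite exchange_big mulr_suml; apply: eq_bigr => i _ /=.
  rewrite /pair_density cA edges_betweenE exchange_big /= natr_sum.
  by congr (_ / _); apply: eq_bigr => y _; rewrite natr_sum.
have [->|ab0] := posnP (a * #|B|); first by rewrite invr0 mulr0 mulrn_wge0.
rewrite ler_pdivrMr ?ltr0n //; apply: le_trans (ler_sum _ hB) _.
by rewrite sumr_const -[leLHS]mulr_natr -[eps *+ s]mulr_natr !natrM !mulrA.
Qed.

(** Some term of a nonpositive sum is nonpositive; the sum is nonempty since
    there are at least two sets. *)
Lemma low_density_pair (R : realType) (V : finType) (G : sgraph V) (eps : R)
    (s n : nat) (W : 'I_s -> {set V}) :
  0 <= eps -> (1 < s)%N -> (forall k, #|W k| = n) -> density R G W <= eps ->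
  exists k l, k != l /\ pair_density R G (W k) (W l) <= eps.
Proof.
move=> e0 s1 cW; rewrite (density_le_excess _ e0 cW) => hex.
have [/existsP[k /existsP[l /andP[kl h]]]|] := boolP [exists k : 'I_s,
    exists l : 'I_s, (k < l)%N && (pair_density R G (W k) (W l) <= eps)].
  by exists k, l; split=> //; apply/eqP => ekl; rewrite ekl ltnn in kl.
rewrite negb_exists => /forallP H; exfalso; move: hex; apply/negP.
rewrite -ltNge.
have hpos (i j : 'I_s) : (i < j)%N -> 0 < pair_density R G (W i) (W j) - eps.
  move=> ij; have := H i; rewrite negb_exists => /forallP /(_ j).
  by rewrite ij /= -ltNge subr_gt0.
pose i0 := Ordinal (ltnW s1); pose i1 := Ordinal s1.
rewrite /excess (bigD1 i0) //= (bigD1 i1) //= -addrA ltr_pwDl ?hpos //.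
apply: addr_ge0; first by apply: sumr_ge0 => j /andP[ij _]; apply/ltW/hpos.
by apply: sumr_ge0 => i _; apply: sumr_ge0 => j ij; apply/ltW/hpos.
Qed.

(** Half of X1 and then half of X2 are kept by bounding degrees.  The density
    eps / 4 may double at each of the two applications of [markov_half], which
    is where the factor 4 comes from.  The set Y2 has to depend on the family
    A, whose sets can occupy a small part of Y1: only the degrees from Y1 to X2
    are controlled in advance. *)
Lemma bipartite_refine (R : realType) (V : finType) (G : sgraph V) (eps : R)
    (X1 X2 : {set V}) :
  0 <= eps -> pair_density R G X1 X2 <= eps / 4 ->
  exists Y1 : {set V}, [/\ Y1 \subset X1, (#|X1| <= 2 * #|Y1|)%N &
    forall (s a : nat) (A : 'I_s -> {set V}),
      (forall i, A i \subset Y1) -> (forall i, #|A i| = a) ->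
      exists Y2 : {set V}, [/\ Y2 \subset X2, (#|X2| <= 2 * #|Y2|)%N &
        forall B : {set V}, B \subset Y2 ->
          \sum_(i < s) (pair_density R G (A i) B - eps) <= 0]].
Proof.
move=> e0; rewrite pair_density_le ?divr_ge0 // => hX.
pose f x : R := \sum_(y in X2) (adj G x y)%:R.
have f0 x : 0 <= f x by apply: sumr_ge0.
exists [set x in X1 | f x <= 2 * (eps / 4 * #|X2|%:R)]; split.
- by apply/subsetP => x; rewrite inE => /andP[].
- apply: markov_half => //; first by rewrite mulr_ge0 ?divr_ge0.
  rewrite mulrAC -mulrA -natrM; apply: le_trans hX.
  by rewrite edges_betweenE natr_sum; apply: ler_sum => x _; rewrite natr_sum.
move=> s a A sA cA.
pose g y : R := \sum_(i < s) \sum_(x in A i) (adj G x y)%:R.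
exists [set y in X2 | g y <= 2 * (eps / 2 * (s * a)%:R)]; split.
- by apply/subsetP => x; rewrite inE => /andP[].
- apply: markov_half => [|y|].
  + by rewrite mulr_ge0 ?divr_ge0.
  + by apply: sumr_ge0 => i _; apply: sumr_ge0.
  rewrite /g exchange_big /=.
  apply: (@le_trans _ _ (\sum_(i < s) \sum_(x in A i) (eps / 2 * #|X2|%:R))).
    apply: ler_sum => i _; rewrite exchange_big /=; apply: ler_sum => x xA.
    have := subsetP (sA i) _ xA; rewrite inE => /andP[_] /le_trans; apply.
    by rewrite le_eqVlt; apply/orP; left; apply/eqP; field.
  under eq_bigr => i _ do rewrite sumr_const cA.
  rewrite sumr_const card_ord -mulrnA mulnC -[leLHS]mulr_natr.
  by rewrite mulrAC lexx.
move=> B /subsetP sB; apply: cross_excess_le0 e0 cA _ => y /sB.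
rewrite inE => /andP[_] /le_trans; apply.
by rewrite le_eqVlt; apply/orP; left; apply/eqP; field.
Qed.

(** * Combining the two hypotheses *)

(** Keep one summand of s i + s' i at a time, and bound each maximum below by
    the corresponding factor. *)
Lemma prod_gain (r : nat) (i : 'I_r) (t : nat) (s s' : 'I_r -> nat) :
  (t <= \prod_(j < r) s j)%N -> (t <= \prod_(j < r) s' j)%N ->
  (2 * t <= \prod_(j < r)
     (if j == i then s j + s' j else maxn (s j) (s' j)))%N.
Proof.
move=> h h'; rewrite (bigD1 i) //= eqxx mulnDl mul2n -addnn leq_add //.
  apply: leq_trans h _; rewrite (bigD1 i) //= leq_mul // leq_prod // => j ji.
  by rewrite (negbTE ji) leq_maxl.
apply: leq_trans h' _; rewrite (bigD1 i) //= leq_mul // leq_prod // => j ji.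
by rewrite (negbTE ji) leq_maxr.
Qed.

Lemma ceil_nat (R : realType) (x : R) : 0 <= x ->
  exists n : nat, n%:Z = Num.ceil x.
Proof.
move=> x0; exists `|Num.ceil x|%N; apply: gez0_abs.
by rewrite -(ceil0 R); apply: le_ceil.
Qed.

Theorem lemma3p2 (R : realType) (V : finType) (r : nat) (G : 'I_r -> sgraph V)
    (alpha rho rho' eps : R) (t : nat)
    (halpha : 0 <= alpha <= 1) (hrho : 0 <= rho <= 1)
    (hrho' : 0 <= rho' <= 1) (heps : 0 <= eps <= 1) (ht : (0 < t)%N)
    (h1 : sparse G (alpha * rho / 2) rho' eps t)
    (h2 : sparse G alpha rho (eps / 4) 2) :
  sparse G alpha (rho * rho' / 2) eps (2 * t).
Proof.
have [e0 _] := andP heps; have [r0 _] := andP hrho; have [r'0 _] := andP hrho'.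
move=> U hU; have [s [s0 sprod hs]] := h2 U hU.
have [i si] : exists i, (1 < s i)%N.
  apply/existsP; rewrite -[X in is_true X]negbK; apply/negP.
  rewrite negb_exists => /forallP H; move: sprod; rewrite big1 // => j _.
  by have := H j; have := s0 j; lia.
have [X [sX dX cX denX]] := hs i.
have [n cn] : exists n : nat, n%:Z = Num.ceil (rho * #|U|%:R).
  by apply: ceil_nat; rewrite mulr_ge0.
have {}cX k : #|X k| = n by apply/eqP; rewrite -eqz_nat cX cn.
have nU : rho * #|U|%:R <= n%:R :> R.
  by rewrite -[n%:R]/(n%:Z%:~R) cn ceil_ge.
have e40 : 0 <= eps / 4 by rewrite divr_ge0.
have [k [l [kl denkl]]] := low_density_pair e40 si cX denX.
have [m cm] : exists m : nat, m%:Z = Num.ceil (rho * rho' / 2 * #|U|%:R).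
  by apply: ceil_nat; rewrite !mulr_ge0 ?invr_ge0.
(* Half of a set of size n has at least rho |U| / 2 elements: enough for the
   first hypothesis to apply, and for its sets to have at least m elements. *)
have halfU (Y : {set V}) : (n <= 2 * #|Y|)%N ->
    rho / 2 * #|U|%:R <= #|Y|%:R :> R.
  by rewrite -(ler_nat R) natrM => h; lra.
have halfV (Y : {set V}) : (n <= 2 * #|Y|)%N ->
    alpha * rho / 2 * #|V|%:R <= #|Y|%:R :> R.
  move=> /halfU; apply: le_trans.
  have := ler_wpM2l r0 hU; lra.
have mle (Y : {set V}) (a : nat) : (n <= 2 * #|Y|)%N ->
    a%:Z = Num.ceil (rho' * #|Y|%:R) -> (m <= a)%N.
  move=> /halfU hY ea; rewrite -lez_nat ea cm le_ceil //.
  have := ler_wpM2l r'0 hY; lra.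
have [Y1 [sY1 cY1 hY1]] := bipartite_refine e0 denkl; rewrite cX in cY1.
have [s1 [s10 s1p hs1]] := h1 Y1 (halfV _ cY1).
have [A [sA dA cA denA]] := hs1 i.
have [a ca] : exists a : nat, a%:Z = Num.ceil (rho' * #|Y1|%:R).
  by apply: ceil_nat; rewrite mulr_ge0.
have {}cA q : #|A q| = a by apply/eqP; rewrite -eqz_nat cA ca.
have [Y2 [sY2 cY2 hY2]] := hY1 _ _ _ sA cA; rewrite cX in cY2.
have [s2 [s20 s2p hs2]] := h1 Y2 (halfV _ cY2).
exists (fun j => if j == i then (s1 j + s2 j)%N else maxn (s1 j) (s2 j)); split.
- by move=> j; case: eqP => _; rewrite ?addn_gt0 ?leq_max s10.
- exact: prod_gain.
move=> j; suff [W [sW dW cW exW]] :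
    exists W : 'I_(if j == i then (s1 j + s2 j)%N else maxn (s1 j) (s2 j))
      -> {set V},
    [/\ forall q, W q \subset U,
        forall p q, p != q -> [disjoint W p & W q],
        forall q, (m <= #|W q|)%N & excess (G j) eps W <= 0].
  have [W' [sW' cW' dW']] := density_shrink e0 cW exW.
  exists W'; split=> // [q|p q pq|q].
  + exact: subset_trans (sW' q) (sW q).
  + exact: disjointWl (sW' p) (disjointWr (sW' q) (dW p q pq)).
  + by rewrite cW' cm.
have Y1U : Y1 \subset U := subset_trans sY1 (sX k).
have Y2U : Y2 \subset U := subset_trans sY2 (sX l).
(* Each family given by the first hypothesis already has the properties
   required of W, except for its length. *)
have sub (Y : {set V}) (w : nat) : Y \subset U -> (n <= 2 * #|Y|)%N ->
    (exists W : 'I_w -> {set V}, [/\ forall k, W k \subset Y,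
              forall k l, k != l -> [disjoint W k & W l],
              forall k, #|W k|%:Z = Num.ceil (rho' * #|Y|%:R)
            & density R (G j) W <= eps]) ->
    exists W : 'I_w -> {set V}, [/\ forall q, W q \subset U,
        forall p q, p != q -> [disjoint W p & W q],
        forall q, (m <= #|W q|)%N & excess (G j) eps W <= 0].
  move=> YU cY [W [sW dW cW denW]]; exists W; split=> // [q|q|].
  + exact: subset_trans (sW q) YU.
  + exact: mle cY (cW q).
  + have [b cb] : exists b : nat, b%:Z = Num.ceil (rho' * #|Y|%:R).
      by apply: ceil_nat; rewrite mulr_ge0.
    have cWb q : #|W q| = b by apply/eqP; rewrite -eqz_nat cW cb.
    by rewrite -(density_le_excess (G j) e0 cWb).
(* For an index other than i, the longer family is kept. *)
have [->{j sub}|ji] := eqVneq j i; last first.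
  by rewrite /maxn; case: ifP => _; [apply: sub Y2U _ _|apply: sub Y1U _ _].
have [B [sB dB cB denB]] := hs2 i.
have [b cb] : exists b : nat, b%:Z = Num.ceil (rho' * #|Y2|%:R).
  by apply: ceil_nat; rewrite mulr_ge0.
have {}cB q : #|B q| = b by apply/eqP; rewrite -eqz_nat cB cb.
have dAB p q : [disjoint A p & B q].
  apply: disjointWl (subset_trans (sA p) sY1) _.
  exact: disjointWr (subset_trans (sB q) sY2) (dX k l kl).
exists (family_cat A B); split.
- move=> q; rewrite /family_cat; case: (split q) => p.
    exact: subset_trans (sA p) Y1U.
  exact: subset_trans (sB p) Y2U.
- move=> p q; rewrite -(inj_eq (can_inj splitK)) /family_cat.
  case: (split p) => p'; case: (split q) => q' //= pq.
  + exact: dA.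
  + by rewrite disjoint_sym.
  + exact: dB.
- move=> q; rewrite /family_cat; case: (split q) => p.
    by rewrite cA; apply: mle cY1 ca.
  by rewrite cB; apply: mle cY2 cb.
rewrite excess_cat -[leRHS]addr0 lerD //; last first.
  by apply: sumr_le0 => q _; apply: hY2.
rewrite -[leRHS]addr0 lerD // -?(density_le_excess _ e0 cA) //.
by rewrite -(density_le_excess _ e0 cB).
Qed.
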